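(* Let $\alpha_0\neq0$, $\mathfrak a>0$, $\epsilon_0=+1$. Let $D\subset\mathbb R^2$ be a connected open set of points $(p,q)$ and $\mathcal P(p),\mathcal Q(q),\Omega(p,q)$ smooth with $\Omega>0$, $\mathcal P>0$, $\mathcal Q>0$, $\mathcal R:=\mathcal Q-\mathcal P>0$ on $D$ (physical Carter region). Suppose that for real constants $\zeta,\mu,\nu,\delta$ $$U:=\Omega^2=1-2\mathfrak a\,pq+\zeta(q^2-p^2)+\mu p^2q+\nu pq^2+\delta p^2q^2,$$ and that the scalar 1-form $C$ is real, exact, not identically zero, and of the form $$\frac{C}{\alpha_0}=\frac{v(q)}{U}\mathrm dp+\frac{u(p)}{U}\mathrm dq,\qquad u=u_0+u_1p+u_2p^2,\quad v=v_0+v_1q+v_2q^2 ,$$ with real constants $u_i,v_i$. If the Einstein reconstruction equations (stated in the context) hold on $D$, then the Maxwell field is aligned: $$B_-=0 .$$ More precisely, the only nonzero scalar branch admitted by the Einstein reconstruction equations is $$U=1-2\mathfrak a\,pq+\delta p^2q^2,\qquad \frac{C}{\alpha_0}=h\,\frac{\mathrm d(pq)}{U},\qquad h^2=\delta-\mathfrak a^2>0 ,$$ with $h$ a real constant. The limiting case $\delta=\mathfrak a^2$ reduces to the bilinear factor $\Omega=1-\mathfrak a\,pq$ and is incompatible with a nonzero scalar 1-form.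
   Context: The setting is Einstein–Maxwell–dilaton theory for a conformal Carter metric $$g=\frac1{\Omega^2}\Big[-\frac{\mathcal Q}{\Sigma}(\mathrm dt-p^2\mathrm d\varphi)^2+\frac{\Sigma}{\mathcal Q}\mathrm dq^2+\frac{\Sigma}{\mathcal P}\mathrm dp^2+\frac{\mathcal P}{\Sigma}(\mathrm dt+q^2\mathrm d\varphi)^2\Big],\qquad \Sigma=p^2+q^2,$$ with scalar field $\phi$, scalar 1-form $C=C_p\mathrm dp+C_q\mathrm dq=\alpha_0\,\mathrm d\phi$, and a complex electromagnetic 1-form $B=B_p\mathrm dp+B_q\mathrm dq$ on the $(p,q)$ plane, which encodes the Maxwell field. Put $B_-:=B_p-iB_q$ and $\mathfrak B_+:=\mathcal QB_q+i\mathcal PB_p$. (The Maxwell field is aligned with the two principal null directions of the Carter metric exactly when $B_-=0$.) The Einstein reconstruction equations (certain components of the Einstein equations) are, with $\epsilon_0=+1$, $$\Omega_{,qq}=\frac{\Omega\mathcal P}{\mathcal R}|B_-|^2+\frac{\epsilon_0\Omega}{\alpha_0^2}C_q^2,\qquad \Omega_{,pp}=-\frac{\Omega\mathcal Q}{\mathcal R}|B_-|^2+\frac{\epsilon_0\Omega}{\alpha_0^2}C_p^2,$$ $$i\Sigma\,\Omega_{,pq}-(q+ip)(\Omega_{,q}+i\Omega_{,p})=-\frac{i\Omega\Sigma}{\mathcal R}B_-\overline{\mathfrak B_+}+\frac{i\epsilon_0\Omega\Sigma}{\alpha_0^2}C_pC_q .$$ Here $B_p,B_q$ are smooth complex functions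 on $D$.
   Formalization: In the limiting case δ=𝔞², the formal conclusion is Ω=1−𝔞pq on D or Ω=−(1−𝔞pq) on D; the second sign occurs when D lies where 𝔞pq>1, since Ω>0 is assumed and U=(1−𝔞pq)². *)

(* Defs.v *)
From HB Require Import structures.
From mathcomp Require Import all_boot all_order all_algebra.
From mathcomp Require Import all_classical all_reals all_analysis.
From mathcomp.real_closed Require Export complex.
Set Implicit Arguments.
Unset Strict Implicit.
Unset Printing Implicit Defensive.
Import Order.TTheory GRing.Theory Num.Theory numFieldNormedType.Exports.
Local Open Scope classical_set_scope.
Local Open Scope ring_scope.

(* A point x : R * R of the plane has coordinates p = x.1 and q = x.2. *)
Section Plane.
Context {R : realType}.
Implicit Types (D : set (R * R)) (f : R * R -> R).

Definition dp f : R * R -> R := 'D_((1, 0) : R * R) f.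
Definition dq f : R * R -> R := 'D_((0, 1) : R * R) f.

Definition iter_partial (s : seq bool) f : R * R -> R :=
  foldr (fun b g => if b then dp g else dq g) f s.

(* C^oo on the (open) set D: the partial derivatives of all orders exist and
   are continuous at every point of D.  Functions are total; their values
   outside D are irrelevant. *)
Definition smooth_on D f : Prop :=
  forall (s : seq bool) (x : R * R), D x ->
    [/\ derivable (iter_partial s f) x ((1, 0) : R * R),
        derivable (iter_partial s f) x ((0, 1) : R * R) &
        {for x, continuous (iter_partial s f)}].

Definition csmooth_on D (g : R * R -> R[i]) : Prop :=
  smooth_on D (fun x => complex.Re (g x)) /\
  smooth_on D (fun x => complex.Im (g x)).

End Plane.

Section Carter.
Context {R : realType}.
Local Open Scope complex_scope.

Definition carter_Sigma (x : R * R) : R := x.1 ^+ 2 + x.2 ^+ 2.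

Definition carter_R (P Q : R -> R) (x : R * R) : R := Q x.2 - P x.1.

(* 'i%C is the pair 0 +i* 1 (the unqualified 'i would be the imaginary unit of
   an abstract numClosedFieldType). *)
Definition B_minus (Bp Bq : R * R -> R[i]) (x : R * R) : R[i] :=
  Bp x - 'i%C * Bq x.

Definition frakB_plus (P Q : R -> R) (Bp Bq : R * R -> R[i]) (x : R * R)
    : R[i] :=
  (Q x.2)%:C * Bq x + 'i%C * (P x.1)%:C * Bp x.

(* Omega_{,pq} is dq (dp Omega); Normc.normc is the real-valued modulus. *)
Definition einstein_reconstruction (D : set (R * R)) (P Q : R -> R)
    (Omega : R * R -> R) (eps0 alpha0 : R) (Cp Cq : R * R -> R)
    (Bp Bq : R * R -> R[i]) : Prop :=
  forall x, D x ->
  let p := x.1 in let q := x.2 in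
  let S := carter_Sigma x in let r := carter_R P Q x in
  let Bm := B_minus Bp Bq x in
  [/\ dq (dq Omega) x =
        Omega x * P p / r * Normc.normc Bm ^+ 2
        + eps0 * Omega x / alpha0 ^+ 2 * Cq x ^+ 2,
      dp (dp Omega) x =
        - (Omega x * Q q / r * Normc.normc Bm ^+ 2)
        + eps0 * Omega x / alpha0 ^+ 2 * Cp x ^+ 2 &
      'i%C * (S * dq (dp Omega) x)%:C
        - (q +i* p) * (dq Omega x +i* dp Omega x) =
      - ('i%C * (Omega x * S / r)%:C * Bm * (frakB_plus P Q Bp Bq x)^*%C)
        + 'i%C * (eps0 * Omega x * S / alpha0 ^+ 2 * Cp x * Cq x)%:C].

Definition Ufactor (a zeta mu nu delta : R) (x : R * R) : R :=
  let p := x.1 in let q := x.2 in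
  1 - 2 * a * p * q + zeta * (q ^+ 2 - p ^+ 2) + mu * p ^+ 2 * q
    + nu * p * q ^+ 2 + delta * p ^+ 2 * q ^+ 2.

End Carter.

(* Main.v *)
Require Import Defs.
From HB Require Import structures.
From mathcomp Require Import all_boot all_order all_algebra.
From mathcomp Require Import all_classical all_reals all_analysis.
From mathcomp.real_closed Require Import complex.
From mathcomp Require Import ring lra.
Import Order.TTheory GRing.Theory Num.Theory numFieldNormedType.Exports.
Local Open Scope classical_set_scope.
Local Open Scope ring_scope.

(* With U = Omega^2, the first two reconstruction equations read
     2 U U_qq - U_q^2 - 4 u^2 =   4 U^2 (P / R) |B_-|^2,
     2 U U_pp - U_p^2 - 4 v^2 = - 4 U^2 (Q / R) |B_-|^2.
   U is quadratic in each variable, so the left-hand sides are discriminants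
   depending on p alone and on q alone; the first is nonnegative and the second
   nonpositive.  Closedness of C = alpha0 dphi is an identity between biquadratic
   polynomials and leaves two possibilities.  Either u = h p, v = h q and
   U = 1 - 2 a p q + delta p^2 q^2, in which case both discriminants are the same
   constant 4 (delta - a^2 - h^2) times p^2 and q^2, hence zero; or
   U = (1 - a p q)^2, in which case the first one is - 4 u^2, so u = 0 and then
   C = 0.  The complex equation is not needed for alignment: as R <> 0, the pair
   (B_-, frakB_+) is an invertible transform of (B_p, B_q). *)

(** * Partial derivatives in the plane: one-variable slices, symmetry of mixed derivatives,
    differentiation rules *)

Section PartialDerivatives.
Context {R : realType}.
Implicit Types (D : set (R * R)) (f g : R * R -> R) (x v : R * R).

(** The two difference quotients are the same function of the increment. This makes the one-variable
    mean value theorem available for [dp], and the next lemma does so for [dq]. *)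
Lemma is_derive_slice1 f x (df : R) :
  is_derive x ((1, 0) : R * R) f df -> is_derive x.1 1 (fun s => f (s, x.2)) df.
Proof.
case: x => p q /= [fx dfx].
have e : (fun h : R => h^-1 *: (((fun s => f (s, q)) \o shift p) (h *: 1) - f (p, q)))
  = (fun h : R => h^-1 *: ((f \o shift (p, q)) (h *: (1, 0)) - f (p, q))).
  apply/funext => h /=; congr (_ *: (f _ - _)).
  by rewrite [RHS]surjective_pairing /= scaler0 add0r.
by split; rewrite /derivable /derive /= e.
Qed.

Lemma is_derive_slice2 f x (df : R) :
  is_derive x ((0, 1) : R * R) f df -> is_derive x.2 1 (fun t => f (x.1, t)) df.
Proof.
case: x => p q /= [fx dfx].
have e : (fun h : R => h^-1 *: (((fun t => f (p, t)) \o shift q) (h *: 1) - f (p, q)))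
  = (fun h : R => h^-1 *: ((f \o shift (p, q)) (h *: (0, 1)) - f (p, q))).
  apply/funext => h /=; congr (_ *: (f _ - _)).
  by rewrite [RHS]surjective_pairing /= scaler0 add0r.
by split; rewrite /derivable /derive /= e.
Qed.

(** The mean value theorem is applied twice: in [s] to the difference of the slices at [q + h] and
    [q], which yields [c], then in [t] to [fs c], which yields [d]. *)
Lemma second_difference (f fs fst : R -> R -> R) (p q h : R) : 0 < h ->
  (forall s t, s \in `[p, p + h] -> t \in `[q, q + h] ->
    is_derive s 1 (f^~ t) (fs s t)) ->
  (forall s t, s \in `[p, p + h] -> t \in `[q, q + h] ->
    is_derive t 1 (fs s) (fst s t)) ->
  exists c d, [/\ c \in `[p, p + h], d \in `[q, q + h] &
    f (p + h) (q + h) - f (p + h) q - f p (q + h) + f p q = fst c d * h ^+ 2].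
Proof.
move=> h0 dfs dfst.
have ph : p < p + h by rewrite ltrDl.
have qh : q < q + h by rewrite ltrDl.
have q0 : q \in `[q, q + h] by rewrite in_itv /= lexx ltW.
have q1 : q + h \in `[q, q + h] by rewrite in_itv /= lexx ltW.
have dg s : s \in `[p, p + h] ->
    is_derive s 1 (f^~ (q + h) - f^~ q) (fs s (q + h) - fs s q).
  by move=> sp; apply: is_deriveB; apply: dfs.
have [|c cp ec] := MVT ph (fun s sp => dg s (subset_itv_oo_cc sp)).
  by apply: derivable_within_continuous => s sp;
    exact: (@ex_derive _ _ _ _ _ _ _ (dg _ sp)).
have {}cp := subset_itv_oo_cc cp.
have [|d dQ ed] := MVT qh (fun t tq => dfst c t cp (subset_itv_oo_cc tq)).
  by apply: derivable_within_continuous => t tq;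
    exact: (@ex_derive _ _ _ _ _ _ _ (dfst _ _ cp tq)).
exists c, d; split => //; first exact: subset_itv_oo_cc dQ.
move: ec ed; rewrite -![(_ - _) _]/(_ - _) => ec ed.
have e2 (z w : R) : w + z - w = z by ring.
rewrite !e2 in ec ed; rewrite ed in ec.
transitivity (f (p + h) (q + h) - f (p + h) q - (f p (q + h) - f p q)); first ring.
by rewrite ec expr2 mulrA.
Qed.

(** Schwarz's theorem. On a small square, the second difference of [f] is the area times either
    mixed derivative at some intermediate point; by continuity both values are within [e / 2] of
    those at [x]. *)
Lemma dpq_comm {D f x} : open D -> smooth_on D f -> D x ->
  dq (dp f) x = dp (dq f) x.
Proof.
move=> oD sf Dx; apply/eqP; rewrite -subr_eq0 -normr_eq0 eq_le normr_ge0 andbT.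
apply/ler_addgt0Pr => e e0; rewrite add0r.
have [_ _ c1] := sf [:: false; true] x Dx.
have [_ _ c2] := sf [:: true; false] x Dx.
move: c1 c2; rewrite /= => /cvgrPdist_lt c1 /cvgrPdist_lt c2.
have e20 : 0 < e / 2 by rewrite divr_gt0.
have nD : nbhs x D by apply: open_nbhs_nbhs.
have nE : nbhs x (D `&` ([set y | `|dq (dp f) x - dq (dp f) y| < e / 2] `&`
    [set y | `|dp (dq f) x - dp (dq f) y| < e / 2])).
  by apply: filterI => //; apply: filterI; [exact: c1|exact: c2].
have [r /= r0 br] := (nbhs_ballP _ _).1 nE.
case: x Dx br {c1 c2 nD nE} => p q Dx br.
(* The side is half the radius, so that the closed square lies in the open ball. *)
have h0 : 0 < r / 2 by rewrite divr_gt0.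
have inb s t : s \in `[p, p + r / 2] -> t \in `[q, q + r / 2] ->
    ball (p, q) r (s, t).
  rewrite !in_itv /= => /andP[s1 s2] /andP[t1 t2].
  by split; rewrite /ball /= ltr_distlC; apply/andP; split; lra.
have inD s t (sp : s \in `[p, p + r / 2]) (tq : t \in `[q, q + r / 2]) : D (s, t)
  by case: (br _ (inb s t sp tq)).
have dfp s t : D (s, t) -> is_derive s 1 (fun s => f (s, t)) (dp f (s, t)).
  by move=> /(sf [::]) [ds _ _]; apply: (@is_derive_slice1 f (s, t)); split.
have dfq s t : D (s, t) -> is_derive t 1 (fun t => f (s, t)) (dq f (s, t)).
  by move=> /(sf [::]) [_ ds _]; apply: (@is_derive_slice2 f (s, t)); split.
have dfpq s t : D (s, t) -> is_derive t 1 (fun t => dp f (s, t)) (dq (dp f) (s, t)).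
  by move=> /(sf [:: true]) [_ ds _]; apply: (@is_derive_slice2 (dp f) (s, t)); split.
have dfqp s t : D (s, t) -> is_derive s 1 (fun s => dq f (s, t)) (dp (dq f) (s, t)).
  by move=> /(sf [:: false]) [ds _ _]; apply: (@is_derive_slice1 (dq f) (s, t)); split.
have [c [d [cp dQ E1]]] := @second_difference (fun s t => f (s, t))
  (fun s t => dp f (s, t)) (fun s t => dq (dp f) (s, t)) p q _ h0
  (fun s t sp tq => dfp s t (inD s t sp tq)) (fun s t sp tq => dfpq s t (inD s t sp tq)).
(* The same second difference with the two variables exchanged, which produces the other mixed
   derivative. *)
have [d' [c' [dQ' cp' E2]]] := @second_difference (fun t s => f (s, t))
  (fun t s => dq f (s, t)) (fun t s => dp (dq f) (s, t)) q p _ h0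
  (fun t s tq sp => dfq s t (inD s t sp tq)) (fun t s tq sp => dfqp s t (inD s t sp tq)).
have E : dq (dp f) (c, d) = dp (dq f) (c', d').
  apply: (mulIf (x := (r / 2) ^+ 2)); first by rewrite expf_neq0 // gt_eqF.
  by apply: etrans (esym E1) _; apply: etrans E2; cbv beta; congr (_ + _); apply: addrAC.
have A : `|dq (dp f) (p, q) - dq (dp f) (c, d)| < e / 2.
  exact: (br _ (inb _ _ cp dQ)).2.1.
have B : `|dq (dp f) (c, d) - dp (dq f) (p, q)| < e / 2.
  rewrite E distrC; exact: (br _ (inb _ _ cp' dQ')).2.2.
apply: le_trans (ler_distD (dq (dp f) (c, d)) _ _) _.
by rewrite [leRHS]splitr; exact: lerD (ltW A) (ltW B).
Qed.

Lemma near_eq_on {D f g x} : open D -> D x -> (forall y, D y -> f y = g y) ->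
  \forall y \near x, f y = g y.
Proof. by move=> oD Dx fg; apply: filterS fg _; exact: open_nbhs_nbhs. Qed.

(** The product rule for an identity known only on [D], which is enough since [D] is a neighbourhood
    of [x]. It allows relations such as [Omega ^+ 2 = U] to be differentiated without roots or
    quotients. *)
Lemma derive_mul_on {D f g h x v} {dh : R} : open D -> D x ->
  derivable f x v -> derivable g x v -> (forall y, D y -> f y * g y = h y) ->
  is_derive x v h dh -> 'D_v f x * g x + f x * 'D_v g x = dh.
Proof.
move=> oD Dx df dg fgh [_ <-].
rewrite -(near_eq_derive v (near_eq_on oD Dx fgh)).
by rewrite (deriveM df dg) addrC; congr (_ + _); exact: mulrC.
Qed.

(** This and the next three lemmas restate the rules of the library for explicit pointwise
    functions, the form in which [derive_poly] meets polynomials. *)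
Lemma is_derive_fun_add f g x v (df dg : R) : is_derive x v f df ->
  is_derive x v g dg -> is_derive x v (fun y => f y + g y) (df + dg).
Proof. exact: is_deriveD. Qed.

Lemma is_derive_fun_opp f x v (df : R) : is_derive x v f df ->
  is_derive x v (fun y => - f y) (- df).
Proof. exact: is_deriveN. Qed.

Lemma is_derive_fun_mul f g x v (df dg : R) : is_derive x v f df ->
  is_derive x v g dg -> is_derive x v (fun y => f y * g y) (f x * dg + g x * df).
Proof. exact: is_deriveM. Qed.

Lemma is_derive_fun_sqr f x v (df : R) : is_derive x v f df ->
  is_derive x v (fun y => f y ^+ 2) (f x * df + f x * df).
Proof. by move=> df'; exact: is_deriveM. Qed.

Lemma is_derive_coord1 x v : is_derive x v (fun y => y.1) v.1.
Proof.
have e : (fun h : R => h^-1 *: (((fun y : R * R => y.1) \o shift x) (h *: v) - x.1))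
    @ 0^' --> v.1.
  apply: cvg_near_cst; near=> h => /=.
  have h0 : h != 0 by near: h; exact: nbhs_dnbhs_neq.
  by rewrite addrK scalerA mulVf // scale1r.
by split; [apply/cvg_ex; exists v.1|exact: cvg_lim e].
Unshelve. all: by end_near. Qed.

Lemma is_derive_coord2 x v : is_derive x v (fun y => y.2) v.2.
Proof.
have e : (fun h : R => h^-1 *: (((fun y : R * R => y.2) \o shift x) (h *: v) - x.2))
    @ 0^' --> v.2.
  apply: cvg_near_cst; near=> h => /=.
  have h0 : h != 0 by near: h; exact: nbhs_dnbhs_neq.
  by rewrite addrK scalerA mulVf // scale1r.
by split; [apply/cvg_ex; exists v.2|exact: cvg_lim e].
Unshelve. all: by end_near. Qed.

End PartialDerivatives.

(** The value of the derivative starts as an existential variable and is built by the rules; after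
    [is_derive_eq], comparing it with the expected polynomial is left to [ring]. *)
Ltac derive_poly := repeat first
  [ exact: is_derive_cst | exact: is_derive_coord1 | exact: is_derive_coord2
  | apply: is_derive_fun_add | apply: is_derive_fun_opp
  | apply: is_derive_fun_sqr | apply: is_derive_fun_mul ].

(** * Derivatives of the biquadratic factor *)

Section Ufactor.
Context {R : realType} (a zeta mu nu delta : R).
Implicit Types x v : R * R.

Definition Up x : R := - (2 * a * x.2) - 2 * zeta * x.1 + 2 * mu * x.1 * x.2
  + nu * x.2 ^+ 2 + 2 * delta * x.1 * x.2 ^+ 2.
Definition Uq x : R := - (2 * a * x.1) + 2 * zeta * x.2 + mu * x.1 ^+ 2
  + 2 * nu * x.1 * x.2 + 2 * delta * x.1 ^+ 2 * x.2.
Definition Upp x : R := - (2 * zeta) + 2 * mu * x.2 + 2 * delta * x.2 ^+ 2.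
Definition Uqq x : R := 2 * zeta + 2 * nu * x.1 + 2 * delta * x.1 ^+ 2.
Definition Upq x : R := - (2 * a) + 2 * mu * x.1 + 2 * nu * x.2
  + 4 * delta * x.1 * x.2.

Lemma is_derive_Ufactor x v :
  is_derive x v (Ufactor a zeta mu nu delta) (v.1 * Up x + v.2 * Uq x).
Proof.
rewrite /Ufactor /=; apply: is_derive_eq; first by derive_poly.
by rewrite /Up /Uq /=; ring.
Qed.

Lemma is_derive_Up x v : is_derive x v Up (v.1 * Upp x + v.2 * Upq x).
Proof.
rewrite /Up /=; apply: is_derive_eq; first by derive_poly.
by rewrite /Upp /Upq /=; ring.
Qed.

Lemma is_derive_Uq x v : is_derive x v Uq (v.1 * Upq x + v.2 * Uqq x).
Proof.
rewrite /Uq /=; apply: is_derive_eq; first by derive_poly.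
by rewrite /Uqq /Upq /=; ring.
Qed.

End Ufactor.

Arguments is_derive_Ufactor {R a zeta mu nu delta} x v.
Arguments is_derive_Up {R a zeta mu nu delta} x v.
Arguments is_derive_Uq {R a zeta mu nu delta} x v.


(** * Polynomial identities on open sets, and the coefficients of the closedness condition *)

Section Polynomials.
Context {R : realType}.

Lemma open_box {D : set (R * R)} {x : R * R} : open D -> D x ->
  exists2 e : R, 0 < e &
    forall s t, `|s - x.1| < e -> `|t - x.2| < e -> D (s, t).
Proof.
move=> oD Dx; have nD : nbhs x D by apply: open_nbhs_nbhs.
have [e /= e0 eD] := (nbhs_ballP _ _).1 nD.
exists e => // s t se te; apply: eD; split; rewrite /ball /= distrC //.
Qed.

(** Three points, [t0] and [t0] plus or minus [e / 2], determine a quadratic polynomial. *)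
Lemma quadratic_eq0 (c0 c1 c2 t0 e : R) : 0 < e ->
  (forall t, `|t - t0| < e -> c0 + c1 * t + c2 * t ^+ 2 = 0) ->
  [/\ c0 = 0, c1 = 0 & c2 = 0].
Proof.
move=> e0 c_eq0.
have := c_eq0 t0; rewrite subrr normr0 => /(_ e0) E0.
have e2 : `|e / 2| < e by rewrite gtr0_norm; lra.
have := c_eq0 (t0 + e / 2); rewrite addrC addKr => /(_ e2) E1.
have := c_eq0 (t0 - e / 2); rewrite addrC addKr normrN => /(_ e2) E2.
have c20 : c2 = 0.
  apply: (mulIf (x := e ^+ 2)); first by rewrite expf_neq0 // gt_eqF.
  by rewrite mul0r; lra.
have c10 : c1 = 0.
  apply: (mulIf (x := e)); first by rewrite gt_eqF.
  by rewrite mul0r; move: E1 E2; rewrite c20; lra.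
by split => //; move: E0; rewrite c10 c20; lra.
Qed.

(** Here [cij] is the coefficient of p^i q^j. Inside a box, the quadratic case is used in p for each
    fixed q, then in q for each of the three coefficients. *)
Lemma biquadratic_eq0 (D : set (R * R)) (c00 c01 c02 c10 c11 c12 c20 c21 c22 : R) :
  open D -> D !=set0 ->
  (forall x : R * R, D x ->
     (c00 + c01 * x.2 + c02 * x.2 ^+ 2) + (c10 + c11 * x.2 + c12 * x.2 ^+ 2) * x.1
     + (c20 + c21 * x.2 + c22 * x.2 ^+ 2) * x.1 ^+ 2 = 0) ->
  [/\ [/\ c00 = 0, c01 = 0 & c02 = 0], [/\ c10 = 0, c11 = 0 & c12 = 0] &
      [/\ c20 = 0, c21 = 0 & c22 = 0]].
Proof.
move=> oD [x Dx] c_eq0; have [e e0 eD] := open_box oD Dx.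
have row t (te : `|t - x.2| < e) :=
  quadratic_eq0 (c00 + c01 * t + c02 * t ^+ 2)
  (c10 + c11 * t + c12 * t ^+ 2) (c20 + c21 * t + c22 * t ^+ 2) _ _ e0
  (fun s se => c_eq0 (s, t) (eD s t se te)).
by split; apply: (quadratic_eq0 _ _ _ x.2 e e0) => t /row [].
Qed.

(** Otherwise p q would be a biquadratic polynomial vanishing on [D] with [c11 = 1]. *)
Lemma open_coord_neq0 (D : set (R * R)) : open D -> D !=set0 ->
  exists2 x, D x & x.1 * x.2 != 0.
Proof.
move=> oD D0; apply: contrapT => noD.
have pq0 (x : R * R) : D x -> x.1 * x.2 = 0.
  by move=> Dx; apply/eqP/negPn/negP => pq; apply: noD; exists x.
have [|_ [_ /eqP + _] _] := biquadratic_eq0 D 0 0 0 0 1 0 0 0 0 oD D0.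
  by move=> x /pq0 pq; rewrite -[RHS]pq; ring.
by rewrite oner_eq0.
Qed.

(** The hypothesis is the closedness of (v dp + u dq) / U with denominators cleared. The two
    outcomes correspond to [u0 ^+ 2 + v0 ^+ 2] being zero or not. *)
Lemma exact_coefficients (D : set (R * R))
    (a zeta mu nu delta u0 u1 u2 v0 v1 v2 : R) :
  open D -> D !=set0 -> 0 < a ->
  (forall x : R * R, D x ->
    (v1 + 2 * v2 * x.2) * Ufactor a zeta mu nu delta x
    - (v0 + v1 * x.2 + v2 * x.2 ^+ 2) * Uq a zeta mu nu delta x =
    (u1 + 2 * u2 * x.1) * Ufactor a zeta mu nu delta x
    - (u0 + u1 * x.1 + u2 * x.1 ^+ 2) * Up a zeta mu nu delta x) ->
  u1 = v1 /\
  ([/\ [/\ u0 = 0, v0 = 0, u2 = 0 & v2 = 0],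
       zeta * u1 = 0, mu * u1 = 0 & nu * u1 = 0] \/
   [/\ zeta = 0, mu = 0, nu = 0, delta = a ^+ 2 &
       [/\ u2 = a * v0, v2 = a * u0 & u0 ^+ 2 + v0 ^+ 2 != 0]]).
Proof.
move=> oD D0 a0 ex.
(* The arguments are the coefficients of v' U - v U_q - u' U + u U_p. *)
have [|[e00 e01 e02] [e10 e11 e12] [e20 e21 _]] := biquadratic_eq0 D
  (v1 - u1) (2 * (v2 - zeta * v0) - 2 * a * u0)
  (- (zeta * v1) - (zeta * u1 - nu * u0))
  (2 * a * v0 - 2 * (u2 + zeta * u0)) (2 * mu * u0 - 2 * nu * v0)
  (- (2 * a * v2) - nu * v1 - 2 * (zeta * u2 - delta * u0))
  (- (zeta * v1) - mu * v0 - zeta * u1)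
  (- (2 * (zeta * v2 + delta * v0)) + 2 * a * u2 + mu * u1)
  (mu * v2 - delta * v1 - nu * u2 + delta * u1) oD D0.
  move=> x /ex /eqP; rewrite -subr_eq0 => /eqP <-.
  by rewrite /Ufactor /Up /Uq; ring.
have uv : u1 = v1 by lra.
split=> //; move: e02 e12 e20 e21; rewrite -{}uv => e02 e12 e20 e21.
have u2E : u2 = a * v0 - zeta * u0 by lra.
have v2E : v2 = zeta * v0 + a * u0 by lra.
have [/eqP|N0] := eqVneq (u0 ^+ 2 + v0 ^+ 2) 0.
  rewrite paddr_eq0 ?sqr_ge0 // !sqrf_eq0 => /andP[/eqP u00 /eqP v00]; left.
  have [u20 v20] : u2 = 0 /\ v2 = 0 by rewrite u2E v2E u00 v00; split; ring.
  by move: e02 e12 e20 e21; rewrite u00 v00 u20 v20 => *; split => //; lra.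
have cancelN z : z * (u0 ^+ 2 + v0 ^+ 2) = 0 -> z = 0.
  by move=> /eqP; rewrite mulf_eq0 (negbTE N0) orbF => /eqP.
(* The difference of [e02] and [e20] is nu u0 + mu v0 = 0, and [e11] is 2 (mu u0 - nu v0) = 0: a
   linear system in mu and nu whose determinant is, up to sign and a factor 2, u0^2 + v0^2. *)
have nu0 : nu = 0.
  apply: cancelN; transitivity (u0 * (- (zeta * u1) - (zeta * u1 - nu * u0))
    - u0 * (- (zeta * u1) - mu * v0 - zeta * u1)
    - v0 / 2 * (2 * mu * u0 - 2 * nu * v0)); first by field.
  by rewrite e02 e11 e20; ring.
have mu0 : mu = 0.
  apply: cancelN; transitivity (v0 * (- (zeta * u1) - (zeta * u1 - nu * u0))
    - v0 * (- (zeta * u1) - mu * v0 - zeta * u1)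
    + u0 / 2 * (2 * mu * u0 - 2 * nu * v0)); first by field.
  by rewrite e02 e11 e20; ring.
rewrite nu0 mu0 u2E v2E in e12 e21.
(* With k = delta - a^2 + zeta^2, [e12] and [e21] now read - 4 a zeta v0 + 2 k u0 = 0 and - 4 a zeta
   u0 - 2 k v0 = 0. One combination isolates zeta and, once zeta = 0, another isolates k. The zeros
   in [u0 * 0] and [v0 * 0] are placeholders rewritten into these left-hand sides. *)
have zeta0 : zeta = 0.
  have : 4 * a * zeta = 0.
    apply: cancelN; transitivity (- (u0 * 0) - v0 * 0 : R); last by ring.
    by rewrite -[in u0 * 0]e21 -[in v0 * 0]e12; ring.
  by move=> /eqP; rewrite !mulf_eq0 pnatr_eq0 (gt_eqF a0) => /eqP.
rewrite zeta0 in e12 e21 u2E v2E *.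
have deltaE : delta - a ^+ 2 = 0.
  apply: cancelN; transitivity ((u0 * 0 - v0 * 0) / 2 : R); last by ring.
  by rewrite -[in u0 * 0]e12 -[in v0 * 0]e21; field.
by right; split => //; [lra|split; [lra|lra|]].
Qed.

End Polynomials.

(** * From the conformal factor to its square, and closedness of the scalar 1-form *)

Section Carter.
Context {R : realType} (a zeta mu nu delta : R) (D : set (R * R)).
Hypothesis oD : open D.
Let U := Ufactor a zeta mu nu delta.

(** The relation [Omega ^+ 2 = U] is differentiated once on all of [D], and the resulting
    first-order relations once more at [x]. *)
Lemma sqrt_factor_derivatives (Omega : R * R -> R) (x : R * R) :
  smooth_on D Omega -> (forall y, D y -> Omega y ^+ 2 = U y) -> D x ->
  [/\ 2 * Omega x * dp Omega x = Up a zeta mu nu delta x,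
      2 * Omega x * dq Omega x = Uq a zeta mu nu delta x,
      2 * dp Omega x ^+ 2 + 2 * Omega x * dp (dp Omega) x =
        Upp zeta mu delta x,
      2 * dq Omega x ^+ 2 + 2 * Omega x * dq (dq Omega) x =
        Uqq zeta nu delta x &
      2 * dq Omega x * dp Omega x + 2 * Omega x * dq (dp Omega) x =
        Upq a mu nu delta x].
Proof.
move=> sO OU Dx.
have dU y v (Dy : D y) (dO : derivable Omega y v) :
    2 * Omega y * 'D_v Omega y = v.1 * Up a zeta mu nu delta y
      + v.2 * Uq a zeta mu nu delta y.
  rewrite -(derive_mul_on oD Dy dO dO OU (is_derive_Ufactor y v)).
  by move: ('D_v Omega y) => d; ring.
have dO1 y : D y -> derivable Omega y (1, 0) by case/(sO [::]).
have dO2 y : D y -> derivable Omega y (0, 1) by case/(sO [::]).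
have E1 y : D y -> 2 * Omega y * dp Omega y = Up a zeta mu nu delta y.
  by move=> Dy; rewrite (dU _ _ Dy (dO1 y Dy)) /= mul1r mul0r addr0.
have E2 y : D y -> 2 * Omega y * dq Omega y = Uq a zeta mu nu delta y.
  by move=> Dy; rewrite (dU _ _ Dy (dO2 y Dy)) /= mul1r mul0r add0r.
have [dp1 dp2 _] := sO [:: true] x Dx.
have [_ dq2 _] := sO [:: false] x Dx.
(* Halving leaves a product of two functions, as [derive_mul_on] expects. *)
have half y (g : R) h : 2 * Omega y * g = h -> Omega y * g = h / 2 by lra.
have dhalf (f : R * R -> R) (v : R * R) (df : R) : is_derive x v f df ->
    is_derive x v (fun y => f y / 2) (df / 2).
  by move=> fx; apply: is_derive_eq; rewrite scaler0 add0r; exact: mulrC.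
have := derive_mul_on oD Dx (dO1 x Dx) dp1 (fun y Dy => half y _ _ (E1 y Dy))
  (dhalf _ _ _ (is_derive_Up x _)).
have := derive_mul_on oD Dx (dO2 x Dx) dp2 (fun y Dy => half y _ _ (E1 y Dy))
  (dhalf _ _ _ (is_derive_Up x _)).
have := derive_mul_on oD Dx (dO2 x Dx) dq2 (fun y Dy => half y _ _ (E2 y Dy))
  (dhalf _ _ _ (is_derive_Uq x _)).
rewrite /= -/(dp _ x) -/(dq _ x) -/(dp (dp Omega) x) -/(dq (dp Omega) x) -/(dq (dq Omega) x).
move: (E1 x Dx) (E2 x Dx).
move: (dp Omega x) (dq Omega x) (dp (dp Omega) x) (dq (dp Omega) x) (dq (dq Omega) x).
by move=> ? ? ? ? ? ? ? ? ? ?; split=> //; lra.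
Qed.

(** The products phi_p U = v and phi_q U = u are differentiated in q and in p, and the common mixed
    derivative of [phi] is eliminated. *)
Lemma exact_closed (phi : R * R -> R) (u0 u1 u2 v0 v1 v2 : R) (x : R * R) :
  smooth_on D phi -> (forall y, D y -> 0 < U y) ->
  (forall y, D y -> dp phi y = (v0 + v1 * y.2 + v2 * y.2 ^+ 2) / U y) ->
  (forall y, D y -> dq phi y = (u0 + u1 * y.1 + u2 * y.1 ^+ 2) / U y) ->
  D x ->
  (v1 + 2 * v2 * x.2) * U x
    - (v0 + v1 * x.2 + v2 * x.2 ^+ 2) * Uq a zeta mu nu delta x =
  (u1 + 2 * u2 * x.1) * U x
    - (u0 + u1 * x.1 + u2 * x.1 ^+ 2) * Up a zeta mu nu delta x.
Proof.
move=> sphi U0 hp hq Dx.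
have hp' y : D y -> dp phi y * U y = v0 + v1 * y.2 + v2 * y.2 ^+ 2.
  by move=> Dy; rewrite hp // divfK // gt_eqF // U0.
have hq' y : D y -> dq phi y * U y = u0 + u1 * y.1 + u2 * y.1 ^+ 2.
  by move=> Dy; rewrite hq // divfK // gt_eqF // U0.
have [_ d1 _] := sphi [:: true] x Dx.
have [d2 _ _] := sphi [:: false] x Dx.
have V1 : is_derive x ((0, 1) : R * R) (fun y => v0 + v1 * y.2 + v2 * y.2 ^+ 2)
    (v1 + 2 * v2 * x.2).
  by apply: is_derive_eq; [derive_poly|rewrite /=; ring].
have V2 : is_derive x ((1, 0) : R * R) (fun y => u0 + u1 * y.1 + u2 * y.1 ^+ 2)
    (u1 + 2 * u2 * x.1).
  by apply: is_derive_eq; [derive_poly|rewrite /=; ring].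
have [dU1 e1] := is_derive_Ufactor (a := a) (zeta := zeta) (mu := mu)
  (nu := nu) (delta := delta) x (0, 1).
have [dU2 e2] := is_derive_Ufactor (a := a) (zeta := zeta) (mu := mu)
  (nu := nu) (delta := delta) x (1, 0).
have := derive_mul_on oD Dx d1 dU1 hp' V1.
have := derive_mul_on oD Dx d2 dU2 hq' V2.
rewrite e1 e2 /= -/(dp (dq phi) x) -/(dq (dp phi) x) (dpq_comm oD sphi Dx).
rewrite (hp _ Dx) (hq _ Dx) -/U; have := U0 x Dx.
move: (U x) (Up _ _ _ _ _ x) (Uq _ _ _ _ _ x) (dp (dq phi) x).
by move=> ux upx uqx d ux0 <- <-; field; rewrite gt_eqF.
Qed.

End Carter.

(** * The reconstruction equations in terms of U, and their converse in the aligned case *)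

Section Reconstruction.
Context {R : realType} (a zeta mu nu delta alpha0 : R) (D : set (R * R)).
Hypotheses (oD : open D) (halpha0 : alpha0 != 0).
Let U := Ufactor a zeta mu nu delta.
Variables (P Q : R -> R) (Omega Cp Cq : R * R -> R) (Bp Bq : R * R -> R[i]).
Hypotheses (hOs : smooth_on D Omega) (hO : forall x, D x -> 0 < Omega x)
  (hU : forall x, D x -> Omega x ^+ 2 = U x).
(** The numerators are arbitrary functions because they are later taken as the given quadratics and
    also as h p and h q. *)
Variables (u v : R * R -> R).
Hypotheses (hCp : forall x, D x -> Cp x / alpha0 = v x / U x)
  (hCq : forall x, D x -> Cq x / alpha0 = u x / U x).

(** Since 2 U U_qq - U_q^2 = 4 Omega^3 Omega_qq, and likewise in p, these are the first two
    equations multiplied by 4 Omega^3. *)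
Lemma reconstruction_discriminants :
  einstein_reconstruction D P Q Omega 1 alpha0 Cp Cq Bp Bq ->
  forall x, D x ->
  2 * U x * Uqq zeta nu delta x - Uq a zeta mu nu delta x ^+ 2 - 4 * u x ^+ 2 =
    4 * U x ^+ 2 * (P x.1 / carter_R P Q x) * Normc.normc (B_minus Bp Bq x) ^+ 2 /\
  2 * U x * Upp zeta mu delta x - Up a zeta mu nu delta x ^+ 2 - 4 * v x ^+ 2 =
    - (4 * U x ^+ 2 * (Q x.2 / carter_R P Q x)
       * Normc.normc (B_minus Bp Bq x) ^+ 2).
Proof.
move=> er x Dx; have [e1 e2 _] := er x Dx.
have [d1 d2 d3 d4 _] := sqrt_factor_derivatives a zeta mu nu delta D oD Omega x hOs hU Dx.
have CqE : Cq x = alpha0 * (u x / U x).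
  by rewrite -hCq // mulrC divfK.
have CpE : Cp x = alpha0 * (v x / U x).
  by rewrite -hCp // mulrC divfK.
rewrite CqE in e1; rewrite CpE in e2.
move: e1 e2; rewrite -d1 -d2 -d3 -d4 -hU //; have := hO _ Dx.
move: (Omega x) (dq (dq Omega) x) (dp (dp Omega) x) (dp Omega x) (dq Omega x).
move: (Normc.normc _) (u x) (v x) => b ux vx om oqq opp op oq om0 -> ->.
rewrite -!mulrA; move: (carter_R P Q x)^-1 => r.
by split; field; rewrite halpha0 gt_eqF.
Qed.

(** With B_- = 0 the electromagnetic terms vanish, and U = 1 - 2 a p q + delta p^2 q^2 gives
    Omega_qq = h^2 p^2 / Omega^3 and Omega_pp = h^2 q^2 / Omega^3, which are the scalar terms. *)
Lemma aligned_reconstruction (h : R) :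
  zeta = 0 -> mu = 0 -> nu = 0 -> h ^+ 2 = delta - a ^+ 2 ->
  (forall x, D x -> u x = h * x.1) -> (forall x, D x -> v x = h * x.2) ->
  (forall x, D x -> B_minus Bp Bq x = 0) ->
  einstein_reconstruction D P Q Omega 1 alpha0 Cp Cq Bp Bq.
Proof.
move=> z0 m0 n0 hh uE vE B0 x Dx /=.
have [d1 d2 d3 d4 d5] := sqrt_factor_derivatives a zeta mu nu delta D oD Omega x hOs hU Dx.
have UE := hU x Dx; have om0 := hO x Dx.
have CqE : Cq x = alpha0 * (h * x.1 / Omega x ^+ 2).
  by rewrite UE -uE // -hCq // mulrC divfK.
have CpE : Cp x = alpha0 * (h * x.2 / Omega x ^+ 2).
  by rewrite UE -vE // -hCp // mulrC divfK.
rewrite B0 // Normc.normc0 CqE CpE expr0n /= !mulr0 oppr0 mul0r oppr0 !add0r.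
move: d1 d2 d3 d4 d5 UE om0.
rewrite /U /Ufactor /Up /Uq /Upp /Uqq /Upq /carter_Sigma {}z0 {}m0 {}n0.
move: (dp Omega x) (dq Omega x) (dp (dp Omega) x) (dq (dp Omega) x) (dq (dq Omega) x).
move: (Omega x) x.1 x.2 => om p q op oq opp opq oqq d1 d2 d3 d4 d5 UE om0.
have omN0 : om != 0 by rewrite gt_eqF.
have dE : delta = h ^+ 2 + a ^+ 2 by rewrite hh subrK.
have opE : op = (delta * p * q ^+ 2 - a * q) / om.
  by apply: (mulfI omN0); rewrite mulrCA divff // mulr1; lra.
have oqE : oq = (delta * p ^+ 2 * q - a * p) / om.
  by apply: (mulfI omN0); rewrite mulrCA divff // mulr1; lra.
have oppE : opp = (delta * q ^+ 2 - op ^+ 2) / om.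
  by apply: (mulfI omN0); rewrite mulrCA divff // mulr1; lra.
have oqqE : oqq = (delta * p ^+ 2 - oq ^+ 2) / om.
  by apply: (mulfI omN0); rewrite mulrCA divff // mulr1; lra.
have opqE : opq = (2 * delta * p * q - a - op * oq) / om.
  by apply: (mulfI omN0); rewrite mulrCA divff // mulr1; lra.
have UE2 : om ^+ 2 = 1 - 2 * a * p * q + delta * p ^+ 2 * q ^+ 2 by rewrite UE; ring.
(* After multiplication by [om ^+ 3] only even powers of [om] remain, and [UE2] makes them
   polynomial. *)
have key (z k : R) : z * om ^+ 3 = k -> z = k / om ^+ 3.
  by move=> <-; rewrite mulfK // expf_neq0.
have oqq3 : oqq = h ^+ 2 * p ^+ 2 / om ^+ 3.
  rewrite oqqE oqE; apply: key.
  transitivity (delta * p ^+ 2 * om ^+ 2 - (delta * p ^+ 2 * q - a * p) ^+ 2); first by field.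
  by rewrite UE2 dE; ring.
have opp3 : opp = h ^+ 2 * q ^+ 2 / om ^+ 3.
  rewrite oppE opE; apply: key.
  transitivity (delta * q ^+ 2 * om ^+ 2 - (delta * p * q ^+ 2 - a * q) ^+ 2); first by field.
  by rewrite UE2 dE; ring.
have opq3 : opq = (h ^+ 2 * p * q + (delta * p * q - a) * om ^+ 2) / om ^+ 3.
  rewrite opqE opE oqE; apply: key.
  transitivity ((2 * delta * p * q - a) * om ^+ 2
    - (delta * p ^+ 2 * q - a * p) * (delta * p * q ^+ 2 - a * q)); first by field.
  by rewrite UE2 dE; ring.
split.
- by rewrite oqq3; field; rewrite ?halpha0 ?omN0.
- by rewrite opp3; field; rewrite ?halpha0 ?omN0.
(* The real part is p Omega_p = q Omega_q, as U depends on p q only; the imaginary part uses q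
   Omega_p + p Omega_q = Sigma (delta p q - a) / Omega. *)
- apply/eqP; rewrite eq_complex /=; apply/andP; split; apply/eqP.
    by rewrite opE oqE; field; rewrite ?halpha0 ?omN0.
  by rewrite opq3 opE oqE; field; rewrite ?halpha0 ?omN0.
Qed.

End Reconstruction.

(** * Classification of the nonzero scalar branch, and the limiting case *)

Theorem mainTheorem3 (R : realType) (alpha0 a : R)
  (halpha0 : alpha0 != 0) (ha : 0 < a)
  (D : set (R * R)) (hDopen : open D) (hDconn : connected D)
  (P Q : R -> R) (Omega : R * R -> R)
  (hPs : smooth_on D (fun x => P x.1))
  (hQs : smooth_on D (fun x => Q x.2))
  (hOs : smooth_on D Omega)
  (hO : forall x, D x -> 0 < Omega x)
  (hP : forall x, D x -> 0 < P x.1)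
  (hQ : forall x, D x -> 0 < Q x.2)
  (hR : forall x, D x -> 0 < carter_R P Q x)
  (zeta mu nu delta : R)
  (hU : forall x, D x -> Omega x ^+ 2 = Ufactor a zeta mu nu delta x)
  (Bp Bq : R * R -> R[i]) (hBp : csmooth_on D Bp) (hBq : csmooth_on D Bq)
  (phi : R * R -> R) (hphi : smooth_on D phi)
  (Cp Cq : R * R -> R)
  (hCp : forall x, D x -> Cp x = alpha0 * dp phi x)
  (hCq : forall x, D x -> Cq x = alpha0 * dq phi x)
  (u0 u1 u2 v0 v1 v2 : R)
  (hCpU : forall x, D x -> Cp x / alpha0 =
     (v0 + v1 * x.2 + v2 * x.2 ^+ 2) / Ufactor a zeta mu nu delta x)
  (hCqU : forall x, D x -> Cq x / alpha0 =
     (u0 + u1 * x.1 + u2 * x.1 ^+ 2) / Ufactor a zeta mu nu delta x) :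
  ((exists x, D x /\ (Cp x, Cq x) <> (0, 0)) ->
    (einstein_reconstruction D P Q Omega 1 alpha0 Cp Cq Bp Bq <->
     (forall x, D x -> B_minus Bp Bq x = 0) /\
     (forall x, Ufactor a zeta mu nu delta x =
        1 - 2 * a * x.1 * x.2 + delta * x.1 ^+ 2 * x.2 ^+ 2) /\
     (exists h : R,
        [/\ forall x, D x -> Cp x / alpha0 =
              h * (dp (fun y => y.1 * y.2) x / Ufactor a zeta mu nu delta x),
            forall x, D x -> Cq x / alpha0 =
              h * (dq (fun y => y.1 * y.2) x / Ufactor a zeta mu nu delta x),
            h ^+ 2 = delta - a ^+ 2 & 0 < delta - a ^+ 2]))) /\
  ((forall x, Ufactor a zeta mu nu delta x =
      1 - 2 * a * x.1 * x.2 + delta * x.1 ^+ 2 * x.2 ^+ 2) ->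
   delta = a ^+ 2 ->
   ((forall x, D x -> Omega x = 1 - a * x.1 * x.2) \/
    (forall x, D x -> Omega x = - (1 - a * x.1 * x.2))) /\
   (einstein_reconstruction D P Q Omega 1 alpha0 Cp Cq Bp Bq ->
    forall x, D x -> (Cp x, Cq x) = (0, 0))).
Proof.
have U0 x : D x -> 0 < Ufactor a zeta mu nu delta x.
  by move=> Dx; rewrite -hU // exprn_gt0 // hO.
have dpE x : D x -> dp phi x =
    (v0 + v1 * x.2 + v2 * x.2 ^+ 2) / Ufactor a zeta mu nu delta x.
  by move=> Dx; rewrite -hCpU // hCp // mulrC mulKf.
have dqE x : D x -> dq phi x =
    (u0 + u1 * x.1 + u2 * x.1 ^+ 2) / Ufactor a zeta mu nu delta x.
  by move=> Dx; rewrite -hCqU // hCq // mulrC mulKf.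
have discr := reconstruction_discriminants a zeta mu nu delta alpha0 D hDopen
  halpha0 P Q Omega Cp Cq Bp Bq hOs hO hU
  (fun x => u0 + u1 * x.1 + u2 * x.1 ^+ 2)
  (fun x => v0 + v1 * x.2 + v2 * x.2 ^+ 2) hCpU hCqU.
have C0 x : D x -> v0 + v1 * x.2 + v2 * x.2 ^+ 2 = 0 ->
    u0 + u1 * x.1 + u2 * x.1 ^+ 2 = 0 -> (Cp x, Cq x) = (0, 0).
  move=> Dx vx ux; congr (_, _).
    by rewrite hCp // dpE // vx mul0r mulr0.
  by rewrite hCq // dqE // ux mul0r mulr0.
have dpxy x : dp (fun y : R * R => y.1 * y.2) x = x.2.
  have [_ e] : is_derive x ((1, 0) : R * R) (fun y => y.1 * y.2) x.2.
    by apply: is_derive_eq; [derive_poly|rewrite /=; ring].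
  exact: e.
have dqxy x : dq (fun y : R * R => y.1 * y.2) x = x.1.
  have [_ e] : is_derive x ((0, 1) : R * R) (fun y => y.1 * y.2) x.1.
    by apply: is_derive_eq; [derive_poly|rewrite /=; ring].
  exact: e.
have forward : (exists x, D x /\ (Cp x, Cq x) <> (0, 0)) ->
    einstein_reconstruction D P Q Omega 1 alpha0 Cp Cq Bp Bq ->
    [/\ forall x, D x -> B_minus Bp Bq x = 0,
        [/\ zeta = 0, mu = 0 & nu = 0],
        [/\ u0 = 0, u2 = 0, v0 = 0 & v2 = 0], u1 = v1 &
        u1 ^+ 2 = delta - a ^+ 2 /\ 0 < delta - a ^+ 2].
  move=> [x0 [Dx0 Cx0]] /discr {}discr; have D0 : D !=set0 by exists x0.
  have [|uv cases] := exact_coefficients D a zeta mu nu delta u0 u1 u2 v0 v1 v2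
      hDopen D0 ha.
    move=> x; exact: exact_closed hDopen _ _ _ _ _ _ _ _ hphi U0 dpE dqE.
  have Pr x : D x -> 0 < P x.1 / carter_R P Q x.
    by move=> Dx; rewrite divr_gt0 ?hP ?hR.
  have Qr x : D x -> 0 < Q x.2 / carter_R P Q x.
    by move=> Dx; rewrite divr_gt0 ?hQ ?hR.
  have nonneg (y z w : R) : 0 < z -> 0 <= 4 * y ^+ 2 * z * w ^+ 2.
    move=> z0; apply: mulr_ge0 (sqr_ge0 w); apply: mulr_ge0 (ltW z0).
    exact: mulr_ge0 (ler0n _ 4) (sqr_ge0 y).
  have cancel (y z w : R) : 0 < y -> 0 < z -> 4 * y ^+ 2 * z * w ^+ 2 = 0 -> w = 0.
    move=> y0 z0 /eqP; rewrite mulf_eq0 sqrf_eq0 => /orP[|/eqP //].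
    by rewrite gt_eqF // mulr_gt0 // mulr_gt0 // exprn_gt0.
  case: cases => [[[u00 v00 u20 v20] zu mu' nu']|[z0 m0 n0 dE [u2E v2E N0]]].
    have h0 : u1 != 0.
      apply/eqP => h0; apply: Cx0; apply: C0 => //.
        by rewrite v00 v20 -uv h0; ring.
      by rewrite u00 u20 h0; ring.
    have cancel_h z : z * u1 = 0 -> z = 0.
      by move=> /eqP; rewrite mulf_eq0 (negbTE h0) orbF => /eqP.
    have [z0 m0 n0] := And3 (cancel_h _ zu) (cancel_h _ mu') (cancel_h _ nu').
    (* First branch: u = h p and v = h q with h = [u1], so both discriminants carry the same
       constant. *)
    have ineq x (Dx : D x) :
        4 * (delta - a ^+ 2 - u1 ^+ 2) * x.1 ^+ 2 =
          4 * Ufactor a zeta mu nu delta x ^+ 2 * (P x.1 / carter_R P Q x)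
          * Normc.normc (B_minus Bp Bq x) ^+ 2 /\
        4 * (delta - a ^+ 2 - u1 ^+ 2) * x.2 ^+ 2 =
          - (4 * Ufactor a zeta mu nu delta x ^+ 2 * (Q x.2 / carter_R P Q x)
             * Normc.normc (B_minus Bp Bq x) ^+ 2).
      have [<- <-] := discr x Dx.
      rewrite /Ufactor /Up /Uq /Upp /Uqq z0 m0 n0 u00 u20 v00 v20 -uv.
      by split; ring.
    (* At a point with p q nonzero, the first equation makes the constant nonnegative and the second
       makes it nonpositive. *)
    have h2 : delta - a ^+ 2 - u1 ^+ 2 = 0.
      have [x Dx] := open_coord_neq0 D hDopen D0.
      rewrite mulf_eq0 negb_or => /andP[p0 q0].
      have [ep eq] := ineq x Dx.
      have : 0 <= 4 * (delta - a ^+ 2 - u1 ^+ 2) * x.1 ^+ 2.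
        by rewrite ep; exact/nonneg/Pr.
      have : 4 * (delta - a ^+ 2 - u1 ^+ 2) * x.2 ^+ 2 <= 0.
        by rewrite eq oppr_le0; exact/nonneg/Qr.
      have p2 : 0 < x.1 ^+ 2 by rewrite exprn_even_gt0.
      have q2 : 0 < x.2 ^+ 2 by rewrite exprn_even_gt0.
      by rewrite (pmulr_lle0 _ q2) (pmulr_lge0 _ p2); lra.
    split=> //; last by rewrite -[delta - _](subrK (u1 ^+ 2)) h2 add0r exprn_even_gt0.
    move=> x Dx; have [/esym + _] := ineq x Dx; rewrite h2 mulr0 mul0r.
    by move=> /(cancel _ _ _ (U0 x Dx) (Pr x Dx)) /Normc.eq0_normc.
  (* Second branch: U = (1 - a p q)^2 satisfies 2 U U_qq = U_q^2, so - 4 u^2 is nonnegative. *)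
  have ux x : D x -> u0 + u1 * x.1 + u2 * x.1 ^+ 2 = 0.
    move=> Dx; have [e _] := discr x Dx.
    apply/eqP; rewrite -sqrf_eq0 eq_le sqr_ge0 andbT.
    rewrite -(pmulr_rle0 _ (ltr0n R 4)) -oppr_ge0.
    have : 0 <= 4 * Ufactor a zeta mu nu delta x ^+ 2 * (P x.1 / carter_R P Q x)
          * Normc.normc (B_minus Bp Bq x) ^+ 2.
      exact/nonneg/Pr.
    by rewrite -e /Ufactor /Uq /Uqq z0 m0 n0 dE; congr (0 <= _); ring.
  have [|[u00 _ _] [u10 _ _] [u20 _ _]] :=
      biquadratic_eq0 D u0 0 0 u1 0 0 u2 0 0 hDopen D0.
    by move=> x /ux ux0; rewrite -[RHS]ux0; ring.
  (* From [u2 = a * v0] and a > 0 follows v0 = 0, against [u0 ^+ 2 + v0 ^+ 2 != 0]. *)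
  move: u2E N0; rewrite u00 u20 => /esym /eqP; rewrite mulf_eq0 gt_eqF //=.
  by move=> /eqP ->; rewrite expr0n addr0 eqxx.
split.
  move=> C_neq0; split=> [er|].
    have [B0 [z0 m0 n0] [u00 u20 v00 v20] uv [hh h0]] := forward C_neq0 er.
    split=> //; split.
      by move=> x; rewrite /Ufactor z0 m0 n0; ring.
    exists u1; split=> // x Dx.
      by rewrite hCpU // dpxy v00 v20 -uv; ring.
    by rewrite hCqU // dqxy u00 u20; ring.
  move=> [B0 [UE [h [hp hq hh h0]]]].
  (* The formula for U holds on the whole plane, so its values at (0, 1), (1, 1) and (1, -1)
     determine zeta, mu and nu. *)
  have z0 : zeta = 0.
    by have := UE (0, 1); rewrite /Ufactor /=; lra.
  have m0 : mu = 0.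
    by have := UE (1, 1); have := UE (1, -1); rewrite /Ufactor /=; lra.
  have n0 : nu = 0.
    by have := UE (1, 1); have := UE (1, -1); rewrite /Ufactor /=; lra.
  apply: (aligned_reconstruction a zeta mu nu delta alpha0 D hDopen halpha0
    P Q Omega Cp Cq Bp Bq hOs hO hU (fun x => h * x.1) (fun x => h * x.2)
    _ _ h z0 m0 n0 hh) => // x Dx.
    by rewrite hp // dpxy mulrA.
  by rewrite hq // dqxy mulrA.
move=> UE dE; split; last first.
  move=> er x Dx; apply: contrapT => Cx.
  have [|_ _ _ _ [_]] := forward _ er; first by exists x.
  by rewrite dE subrr ltxx.
have sq x : D x -> Omega x ^+ 2 = (1 - a * x.1 * x.2) ^+ 2.
  by move=> Dx; rewrite hU // UE dE; ring.
(* Since Omega > 0, the function 1 - a p q has no zero on [D]; its image is an interval because [D]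
   is connected, so its sign is constant and selects the square root. *)
have g0 x : D x -> 1 - a * x.1 * x.2 != 0.
  by move=> Dx; rewrite -sqrf_eq0 -sq // sqrf_eq0 gt_eqF // hO.
have cg : continuous (fun x : R * R => 1 - a * x.1 * x.2).
  move=> x; apply: cvgB; first exact: cvg_cst.
  by apply: cvgM; [apply: cvgMr; exact: cvg_fst|exact: cvg_snd].
have := connected_continuous_connected hDconn (continuous_subspaceT cg).
move=> /connected_intervalP itvg.
have [[x [Dx gx]]|neg] := pselect (exists x, D x /\ 0 < 1 - a * x.1 * x.2).
  left=> y Dy; have gy : 0 < 1 - a * y.1 * y.2.
    rewrite ltNge; apply/negP => gy.
    have [|z Dz /eqP] := itvg _ _ (imageP _ Dy) (imageP _ Dx) 0.
      by rewrite gy ltW.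
    by rewrite (negbTE (g0 z Dz)).
  by apply/eqP; rewrite -(eqrXn2 (n := 2)) ?sq // ltW // hO.
right=> y Dy; have gy : 1 - a * y.1 * y.2 <= 0.
  by rewrite leNgt; apply/negP => gy; apply: neg; exists y.
by apply/eqP; rewrite -(eqrXn2 (n := 2)) ?sqrrN ?sq // ?oppr_ge0 // ltW // hO.
Qed.
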